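(* Work in the setting of the context (linear observation model $b=Ax^*+\varpi$ with $x^*\in\mathcal{X}$, $\overline{S}=\{i:x^*_{J_i}\ne0\}$, $\overline{r}=|\overline{S}|$, loss $\vartheta(z)=\frac1n\sum_{i=1}^n\theta(z_i)$, and $\{x^k\}$ generated by the inexact proximal MM algorithm). Let $c>2$ be a constant. Suppose there is $\kappa>0$ such that $\frac{1}{2n}\|Ax\|^2\ge\kappa\|x\|^2$ for all $x\in\mathcal{C}(\overline{S},1.5\overline{r})$, and that for some $k\ge1$ there exists an index set $S^{k-1}\subseteq\{1,\dots,m\}$ with $S^{k-1}\supseteq\overline{S}$ and $|S^{k-1}|\le1.5\overline{r}$ such that $\max_{i\in(S^{k-1})^c}w_i^{k-1}\le\frac12$. If $\lambda$ satisfies $$c\big(\|G(\xi^k)\|_\infty+2n^{-1}\widetilde\rho\,|\!|\!|A_{\overline{J}\cdot}|\!|\!|_1\big)\le\lambda<\frac{2\mu\|\varpi\|_\infty+\frac{\kappa\overline\rho}{\widetilde\rho}-\frac{3c\|A\|_\infty}{c-2}\big(\|G(\xi^k)\|_\infty+2n^{-1}\widetilde\rho\,|\!|\!|A_{\overline{J}\cdot}|\!|\!|_1\big)|S^{k-1}|}{\frac{3c\|A\|_\infty}{c-2}\|v^{k-1}_{\overline{S}}\|_\infty|S^{k-1}|},$$ then $\|x^k-x^*\|\le\frac{d_1}{d_2}$, where $$d_1:=2\|\varpi\|_\infty\big(\|G(\xi^k)\|_\infty+2n^{-1}\widetilde\rho\,|\!|\!|A_{\overline{J}\cdot}|\!|\!|_1+\lambda\|v^{k-1}_{\overline{S}}\|_\infty\big)\sqrt{|S^{k-1}|},$$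 $$d_2:=2\mu\|\varpi\|_\infty+\frac{\overline\rho\kappa}{\widetilde\rho}-\frac{3c}{c-2}\|A\|_\infty\big(\|G(\xi^k)\|_\infty+2n^{-1}\widetilde\rho\,|\!|\!|A_{\overline{J}\cdot}|\!|\!|_1+\lambda\|v^{k-1}_{\overline{S}}\|_\infty\big)|S^{k-1}|.$$
   Context: Data. $A\in\mathbb{R}^{n\times p}$; $\mathcal{X}\subseteq\mathbb{R}^p$ nonempty closed convex; $J_1,\dots,J_m$ a partition of $\{1,\dots,p\}$; $x_{J_i}$ is the subvector of $x$ indexed by $J_i$; $G(x):=(\|x_{J_1}\|,\dots,\|x_{J_m}\|)^{\top}$. $\|\cdot\|$ is the Euclidean norm, and the spectral norm for matrices; $\|A\|_\infty$ is the maximum absolute row sum of $A$, while for vectors $\|\cdot\|_\infty$ is the max norm; $\|x\|_M^2:=\langle x,Mx\rangle$; $e$ is the all-ones vector; $[m]=\{1,\dots,m\}$; $v_S$ is the subvector of $v$ indexed by $S$. Observation model: $b=Ax^*+\varpi$, where $x^*\in\mathcal{X}$ is the true vector and $\varpi\in\mathbb{R}^n$ the noise; $\overline{S}:=\{i\in[m]:x^*_{J_i}\ne0\}$, $\overline{r}:=|\overline{S}|$; $\overline{J}:=\{i\in\{1,\dots,n\}:\varpi_i\ne0\}$; $A_{\overline{J}\cdot}$ is the submatrix of rows of $A$ indexed by $\overline{J}$. For a matrix $M$ with $p$ columns, $|\!|\!|M|\!|\!|_1$ is the smallest constant $C$ with $\|Mz\|_1\le C\|G(z)\|_1$ for all $z\in\mathbb{R}^p$.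 Assumption on the loss. $\vartheta(z)=\frac1n\sum_{i=1}^n\theta(z_i)$, where $\theta:\mathbb{R}\to\mathbb{R}_+$ is convex, $\theta(0)=0$, $\theta^2$ is strongly convex with modulus $\overline\rho>0$ (i.e. $\theta^2-\frac{\overline\rho}{2}(\cdot)^2$ is convex), and $\widetilde\rho>0$ is such that $|\eta|\le\widetilde\rho$ for every $t\in\mathbb{R}$ and $\eta\in\partial\theta(t)$. Cone. For a positive number $r$ and the constant $c>2$, $\mathcal{C}(\overline{S},r)$ is the set of $x\in\mathbb{R}^p$ for which there exists $S\supset\overline{S}$ with $|S|\le r$ and $\sum_{i\in S^c}\|x_{J_i}\|\le\frac{2(c+1)}{c-2}\sum_{i\in S}\|x_{J_i}\|$. Function classes. $\mathscr{L}$ is the set of closed proper convex $\phi:\mathbb{R}\to(-\infty,\infty]$ with ${\rm int}({\rm dom}\,\phi)\supseteq[0,1]$, $\phi(1)=1$, $\phi(t^* )=0$ where $t^*=\arg\min_{0\le t\le1}\phi(t)$; $\mathscr{L}_1$ is the set of $\phi\in\mathscr{L}$ strictly convex on $[0,1]$. $\psi:=\phi$ on $[0,1]$, $+\infty$ elsewhere; $\psi^*$ is its convex conjugate (continuously differentiable when $\phi\in\mathscr{L}_1$). Algorithm (inexact proximal MM). Choose $\phi\in\mathscr{L}_1$, $\mu>0$, $\nu>0$, $\rho\ge1$, $\varrho\in(0,1]$, $0<\underline{\gamma_1}\le\gamma_{1,0}$, $0<\underline{\gamma_2}\le\gamma_{2,0}$, and $x^0\in\mathcal{X}$ (an approximate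 minimizer over $\mathcal X$ of $\vartheta(Ax-b)+\widetilde\lambda\langle e,G(x)\rangle+\frac{\widetilde\gamma_{1,0}}{2}\|x\|^2+\frac{\widetilde\gamma_{2,0}}{2}\|Ax\|^2$ for some $\widetilde\lambda>0$, $\widetilde\gamma_{1,0}\ge\gamma_{1,0}$, $\widetilde\gamma_{2,0}\ge\gamma_{2,0}$); put $x^{-1}:=x^0$, $\lambda:=\rho\nu$, $Q:=\underline{\gamma_1}I+\underline{\gamma_2}A^{\top}A$. For $k=0,1,2,\dots$: set $w_i^k:=(\psi^* )'(\rho\|x^k_{J_i}\|)$, $i\in[m]$, and $v^k:=e-w^k$; take any $\delta^k\in\mathbb{R}^p$ with $\|\delta^k\|\le\frac{\|Q^{1/2}(x^k-x^{k-1})\|}{\sqrt2\|Q^{-1/2}\|}$; set $Q_k:=\gamma_{1,k}I+\gamma_{2,k}A^{\top}A$ and let $x^{k+1}$ be the unique minimizer over $x\in\mathcal{X}$ of $\vartheta(Ax-b)+\frac{\mu}{2}\|x\|^2+\lambda\langle v^k,G(x)\rangle+\frac12\|x-x^k\|^2_{Q_k}-\langle\delta^k,x-x^k\rangle$; update $\gamma_{j,k+1}:=\max(\underline{\gamma_j},\varrho\gamma_{j,k})$, $j=1,2$. Notation along the iterates. $\xi^k:=Q_{k-1}(x^{k-1}-x^k)+\delta^{k-1}-\mu x^*$. *)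

(* Defs.v *)
From HB Require Import structures.
From mathcomp Require Import all_boot all_order all_algebra.
From mathcomp Require Import all_classical all_reals all_analysis.

Set Implicit Arguments.
Unset Strict Implicit.
Unset Printing Implicit Defensive.
Import Order.TTheory GRing.Theory Num.Theory.
Import numFieldNormedType.Exports.

Local Open Scope classical_set_scope.
Local Open Scope ring_scope.

Section Norms.
Context {R : realType}.

Definition inner n (x y : 'cV[R]_n) : R := (x^T *m y) 0 0.

(* On 'cV[R]_n the library norm `|x| is the max norm. *)
Definition enorm n (x : 'cV[R]_n) : R := Num.sqrt (inner x x).
Definition norm1 n (x : 'cV[R]_n) : R := \sum_i `|x i 0|.

Definition sqnorm_wrt n (M : 'M[R]_n) (x : 'cV[R]_n) : R := inner x (M *m x).

Definition spectral_norm k n (M : 'M[R]_(k, n)) : R :=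
  sup [set enorm (M *m x) | x in [set x : 'cV[R]_n | enorm x <= 1]].

Definition max_row_sum k n (M : 'M[R]_(k, n)) : R :=
  \big[Num.max/0]_i \sum_j `|M i j|.

Definition is_psd n (M : 'M[R]_n) : Prop :=
  M^T = M /\ forall x : 'cV[R]_n, 0 <= inner x (M *m x).

(* The positive semidefinite square root; it exists and is unique when Q is
   positive semidefinite, which is the only case in which it is used. *)
Definition sqrtmx n (Q : 'M[R]_n) : 'M[R]_n :=
  xget 0 [set B : 'M[R]_n | is_psd B /\ B *m B = Q].

(* Rows of M indexed by S, in increasing order; for a column vector this is
   the subvector indexed by S. *)
Definition subrows k n (S : {set 'I_k}) (M : 'M[R]_(k, n)) : 'M[R]_(#|S|, n) :=
  rowsub (fun i : 'I_#|S| => enum_val i) M.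

Definition supp n (z : 'cV[R]_n) : {set 'I_n} := [set i | z i 0 != 0]%SET.

End Norms.

Section Groups.
Context {R : realType} (p m : nat) (J : 'I_m -> {set 'I_p}).

(* J_1, ..., J_m are distinct, nonempty, and partition the index set. *)
Definition is_indexed_partition : Prop :=
  injective J /\ finset.partition (J @: [set: 'I_m])%SET [set: 'I_p]%SET.

Definition group_norms (x : 'cV[R]_p) : 'cV[R]_m :=
  \col_i enorm (subrows (J i) x).

Definition group_supp (x : 'cV[R]_p) : {set 'I_m} :=
  [set i | subrows (J i) x != 0]%SET.

Definition triple_norm1 k (M : 'M[R]_(k, p)) : R :=
  inf [set C : R | forall z : 'cV[R]_p,
         norm1 (M *m z) <= C * norm1 (group_norms z)].

Definition group_cone (c : R) (Sbar : {set 'I_m}) (r : R) : set 'cV[R]_p :=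
  [set x | exists S : {set 'I_m},
     [/\ Sbar \subset S, #|S|%:R <= r &
         \sum_(i in ~: S) enorm (subrows (J i) x)
           <= 2 * (c + 1) / (c - 2) * \sum_(i in S) enorm (subrows (J i) x)]].

End Groups.

Section Loss.
Context {R : realType}.

Definition subdifferential (f : R -> R) (t : R) : set R :=
  [set eta | forall s, f t + eta * (s - t) <= f s].

Record loss_assumption (theta : R -> R) (rhobar rhotilde : R) : Prop := {
  loss_ge0 : forall t, 0 <= theta t;
  loss_convex : @convex_function R R^o setT theta;
  loss_at0 : theta 0 = 0;
  loss_modulus_gt0 : 0 < rhobar;
  loss_sq_strongly_convex :
    @convex_function R R^o setT
      (fun t => theta t ^+ 2 - rhobar / 2 * t ^+ 2);
  loss_bound_gt0 : 0 < rhotilde;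
  loss_subdifferential_bound :
    forall t eta, subdifferential theta t eta -> `|eta| <= rhotilde }.

Definition loss (theta : R -> R) n (z : 'cV[R]_n) : R :=
  n%:R^-1 * \sum_i theta (z i 0).

End Loss.

Section FunctionClass.
Context {R : realType}.
Implicit Types phi : R -> \bar R.

Definition econvex phi : Prop :=
  forall (a s t : R), 0 <= a <= 1 ->
    (phi (a * s + (1 - a) * t)%R <= a%:E * phi s + (1 - a)%:E * phi t)%E.

Definition strictly_convex_on (D : set R) phi : Prop :=
  forall (a s t : R), 0 < a < 1 -> D s -> D t -> s <> t ->
    (phi (a * s + (1 - a) * t)%R < a%:E * phi s + (1 - a)%:E * phi t)%E.

Record classL phi : Prop := {
  classL_proper : (forall t, phi t != -oo%E) /\ (exists t, phi t != +oo%E);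
  classL_convex : econvex phi;
  classL_closed : lower_semicontinuous phi;
  classL_dom : `[0, 1]%classic `<=` [set t | (phi t < +oo)%E]°;
  classL_at1 : phi 1 = 1%E;
  classL_argmin : exists tstar : R,
    [/\ 0 <= tstar <= 1,
        forall t, 0 <= t <= 1 -> (phi tstar <= phi t)%E &
        phi tstar = 0%E] }.

Definition classL1 phi : Prop :=
  classL phi /\ strictly_convex_on `[0, 1]%classic phi.

Definition restrict01 phi : R -> \bar R :=
  fun t => if 0 <= t <= 1 then phi t else +oo%E.

Definition conjugate (f : R -> \bar R) (s : R) : \bar R :=
  ereal_sup [set ((s * t)%:E - f t)%E | t in [set: R]].

(* (psi^* )', where psi is phi restricted to [0, 1]; psi^* is finite everywhere
   for phi in the class, so that fine loses nothing. *)
Definition conj_deriv phi : R -> R :=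
  derive1 (fun s : R => fine (conjugate (restrict01 phi) s) : R^o).

End FunctionClass.

Section Algorithm.
Context {R : realType} (n p m : nat).
Variables (A : 'M[R]_(n, p)) (b : 'cV[R]_n) (X : set 'cV[R]_p).
Variables (J : 'I_m -> {set 'I_p}) (theta : R -> R).

Definition weight (phi : R -> \bar R) (rho : R) (x : 'cV[R]_p) : 'cV[R]_m :=
  \col_i conj_deriv phi (rho * enorm (subrows (J i) x)).

Definition prox_mx (g1 g2 : R) : 'M[R]_p := g1%:M + g2 *: (A^T *m A).

Definition init_objective (lam g1 g2 : R) (x : 'cV[R]_p) : R :=
  loss theta (A *m x - b) + lam * inner (const_mx 1) (group_norms J x)
  + g1 / 2 * enorm x ^+ 2 + g2 / 2 * enorm (A *m x) ^+ 2.

Definition subproblem_objective (mu lam : R) (v : 'cV[R]_m) (Qk : 'M[R]_p)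
    (xk deltak x : 'cV[R]_p) : R :=
  loss theta (A *m x - b) + mu / 2 * enorm x ^+ 2
  + lam * inner v (group_norms J x)
  + 2^-1 * sqnorm_wrt Qk (x - xk) - inner deltak (x - xk).

Definition is_minimizer (F : 'cV[R]_p -> R) (x : 'cV[R]_p) : Prop :=
  X x /\ forall y, X y -> F x <= F y.

(* The tolerance eps is not prescribed, only its existence. *)
Definition is_approx_minimizer (F : 'cV[R]_p -> R) (x : 'cV[R]_p) : Prop :=
  X x /\ exists eps : R, 0 <= eps /\ forall y, X y -> F x <= F y + eps.

(* The convention x^{-1} := x^0 is rendered by x k.-1, since 0.-1 = 0.  The
   subproblem is strongly convex on X, so that its minimizer is unique. *)
Record inexact_pmm (phi : R -> \bar R)
    (mu nu rho varrho g1low g2low : R)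
    (x delta : nat -> 'cV[R]_p) (g1 g2 : nat -> R) : Prop := {
  pmm_phi : classL1 phi;
  pmm_mu : 0 < mu;
  pmm_nu : 0 < nu;
  pmm_rho : 1 <= rho;
  pmm_varrho : 0 < varrho <= 1;
  pmm_g1low : 0 < g1low <= g1 0%N;
  pmm_g2low : 0 < g2low <= g2 0%N;
  pmm_init : exists lam0 g10 g20 : R,
    [/\ 0 < lam0, g1 0%N <= g10, g2 0%N <= g20 &
        is_approx_minimizer (init_objective lam0 g10 g20) (x 0%N)];
  pmm_delta : forall k,
    let Q := prox_mx g1low g2low in
    enorm (delta k)
      <= enorm (sqrtmx Q *m (x k - x k.-1))
         / (Num.sqrt 2 * spectral_norm (invmx (sqrtmx Q)));
  pmm_step : forall k,
    is_minimizer
      (subproblem_objective mu (rho * nu) (const_mx 1 - weight phi rho (x k))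
         (prox_mx (g1 k) (g2 k)) (x k) (delta k))
      (x k.+1);
  pmm_g1 : forall k, g1 k.+1 = Num.max g1low (varrho * g1 k);
  pmm_g2 : forall k, g2 k.+1 = Num.max g2low (varrho * g2 k) }.

Definition xi (mu : R) (xstar : 'cV[R]_p) (x delta : nat -> 'cV[R]_p)
    (g1 g2 : nat -> R) (k : nat) : 'cV[R]_p :=
  prox_mx (g1 k.-1) (g2 k.-1) *m (x k.-1 - x k) + delta k.-1 - mu *: xstar.

End Algorithm.

(* Main.v *)
(* Write D = x^k - xstar, g_i = |D_{J_i}|, s = sum_{i in S} g_i and t = sum_{i notin S} g_i.
   Comparing x^k with xstar in the k-th subproblem gives
     theta-loss(A D - varpi) - theta-loss(- varpi) + mu |D|^2
       + lambda <v, G(x^k) - G(xstar)> <= <xi^k, D>.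
   Here v takes values in [0, 1], because w is a derivative of the conjugate of psi, whose
   difference quotients lie in [0, 1]; hence <v, G(x^k) - G(xstar)> >= t / 2 - vmax s.
   The strong convexity of theta^2 together with the rhotilde-Lipschitz property of
   theta, applied to theta(z) - theta(u) = (theta(z)^2 - theta(u)^2) / (theta(z) + theta(u)),
   bounds the loss difference below by a multiple of
   |A D|^2 / (|A D|_oo + 2 |varpi|_oo), up to an error supported where varpi <> 0.
   With c B <= lambda this puts D in the cone, so that |A D|^2 >= 2 n kappa |D|^2 and
   |A D|_oo <= |A|_oo (s + t) <= 3 c / (c - 2) |A|_oo s; then s <= sqrt |S| |D| and
   multiplying out the denominator |A D|_oo + 2 |varpi|_oo yields d2 |D| <= d1. *)

Require Import Defs.
From HB Require Import structures.
From mathcomp Require Import all_boot all_order all_algebra.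
From mathcomp Require Import all_classical all_reals all_analysis.
From mathcomp Require Import ring lra.

Set Implicit Arguments.
Unset Strict Implicit.
Unset Printing Implicit Defensive.
Import Order.TTheory GRing.Theory Num.Theory.
Import numFieldNormedType.Exports.

Local Open Scope classical_set_scope.
Local Open Scope ring_scope.

(** * Inner products, Euclidean norms and max norms of column vectors *)

Section Inner.
Context {R : realType}.
Implicit Types (n : nat) (a : R).

Lemma innerE n (x y : 'cV[R]_n) : inner x y = \sum_i x i 0 * y i 0.
Proof. by rewrite /inner mxE; apply: eq_bigr => i _; rewrite mxE. Qed.

Lemma innerC n (x y : 'cV[R]_n) : inner x y = inner y x.
Proof. by rewrite !innerE; apply: eq_bigr => i _; rewrite mulrC. Qed.

Lemma innerDr n (x y z : 'cV[R]_n) : inner x (y + z) = inner x y + inner x z.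
Proof. by rewrite /inner mulmxDr mxE. Qed.

Lemma innerZr n a (x y : 'cV[R]_n) : inner x (a *: y) = a * inner x y.
Proof. by rewrite /inner -scalemxAr mxE. Qed.

Lemma innerNr n (x y : 'cV[R]_n) : inner x (- y) = - inner x y.
Proof. by rewrite /inner mulmxN mxE. Qed.

Lemma innerDl n (x y z : 'cV[R]_n) : inner (x + y) z = inner x z + inner y z.
Proof. by rewrite innerC innerDr !(innerC z). Qed.

Lemma innerZl n a (x y : 'cV[R]_n) : inner (a *: x) y = a * inner x y.
Proof. by rewrite innerC innerZr innerC. Qed.

Lemma innerNl n (x y : 'cV[R]_n) : inner (- x) y = - inner x y.
Proof. by rewrite innerC innerNr innerC. Qed.

Lemma inner_symm n (M : 'M[R]_n) (x y : 'cV[R]_n) :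
  M^T = M -> inner x (M *m y) = inner y (M *m x).
Proof. by move=> MT; rewrite innerC /inner trmx_mul MT -mulmxA. Qed.

Lemma inner_ge0 n (x : 'cV[R]_n) : 0 <= inner x x.
Proof. by rewrite innerE sumr_ge0 // => i _; rewrite -expr2 sqr_ge0. Qed.

Lemma enorm_ge0 n (x : 'cV[R]_n) : 0 <= enorm x.
Proof. exact: sqrtr_ge0. Qed.

Lemma sqr_enorm n (x : 'cV[R]_n) : enorm x ^+ 2 = inner x x.
Proof. by rewrite /enorm sqr_sqrtr // inner_ge0. Qed.

Lemma sqr_enormE n (x : 'cV[R]_n) : enorm x ^+ 2 = \sum_i x i 0 ^+ 2.
Proof. by rewrite sqr_enorm innerE. Qed.

Lemma enorm_eq0 n (x : 'cV[R]_n) : (enorm x == 0) = (x == 0).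
Proof.
apply/eqP/eqP => [x0|->]; last by rewrite /enorm /inner mulmx0 mxE sqrtr0.
have : \sum_i x i 0 ^+ 2 = 0 by rewrite -sqr_enormE x0 expr0n.
move/eqP; rewrite psumr_eq0; last by move=> i _; rewrite sqr_ge0.
move=> /allP x_0; apply/matrixP => i j; rewrite ord1 mxE.
by have := x_0 i (mem_index_enum i); rewrite /= sqrf_eq0 => /eqP.
Qed.

Lemma inner_le_enorm n (x y : 'cV[R]_n) : inner x y <= enorm x * enorm y.
Proof.
have [x0|x0] := eqVneq x 0.
  by rewrite x0 /inner trmx0 mul0mx mxE mulr_ge0 ?enorm_ge0.
have [y0|y0] := eqVneq y 0.
  by rewrite y0 /inner mulmx0 mxE mulr_ge0 ?enorm_ge0.
have xn : 0 < enorm x by rewrite lt_def enorm_eq0 x0 enorm_ge0.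
have yn : 0 < enorm y by rewrite lt_def enorm_eq0 y0 enorm_ge0.
have := inner_ge0 (enorm y *: x - enorm x *: y).
rewrite !(innerDl, innerDr, innerNl, innerNr, innerZl, innerZr) (innerC y x).
rewrite -!sqr_enorm => H.
have : 0 <= (2 * enorm x * enorm y) * (enorm x * enorm y - inner x y) by nra.
by rewrite pmulr_rge0 ?subr_ge0 // !mulr_gt0.
Qed.

Lemma enormZ n a (x : 'cV[R]_n) : enorm (a *: x) = `|a| * enorm x.
Proof.
rewrite /enorm innerZl innerZr mulrA -expr2 sqrtrM ?sqr_ge0 //.
by rewrite sqrtr_sqr.
Qed.

Lemma enormN n (x : 'cV[R]_n) : enorm (- x) = enorm x.
Proof. by rewrite -scaleN1r enormZ normrN1 mul1r. Qed.

Lemma enormD n (x y : 'cV[R]_n) : enorm (x + y) <= enorm x + enorm y.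
Proof.
rewrite -(@ler_pXn2r _ 2) ?nnegrE ?addr_ge0 ?enorm_ge0 //.
rewrite sqr_enorm innerDl !innerDr (innerC y x) -!sqr_enorm.
by have := inner_le_enorm x y; lra.
Qed.

Lemma enormB_ge n (x y : 'cV[R]_n) : enorm y - enorm (x - y) <= enorm x.
Proof.
rewrite lerBlDr; have := enormD x (- (x - y)).
by rewrite enormN opprB addrC subrK.
Qed.

Lemma ler_coord_enorm n (x : 'cV[R]_n) i : `|x i 0| <= enorm x.
Proof.
rewrite -(@ler_pXn2r _ 2) ?nnegrE ?enorm_ge0 // sqr_enormE real_normK ?num_real //.
by rewrite (bigD1 i) //= lerDl sumr_ge0 // => j _; rewrite sqr_ge0.
Qed.

Lemma coord_le_mx_norm n (x : 'cV[R]_n) i : `|x i 0| <= `|x|.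
Proof.
rewrite [leRHS]/Num.norm /= mx_normrE.
exact: (le_bigmax _ (fun ij : 'I_n * 'I_1 => `|x ij.1 ij.2|) (i, 0)).
Qed.

Lemma mx_norm_le n (x : 'cV[R]_n) a :
  0 <= a -> (forall i, `|x i 0| <= a) -> `|x| <= a.
Proof.
move=> a0 xa; rewrite [leLHS]/Num.norm /= mx_normrE.
by apply: bigmax_le => //= -[i j] _ /=; rewrite ord1.
Qed.

Lemma ler_mul_max_row_sum k n (M : 'M[R]_(k, n)) (z : 'cV[R]_n) a :
  0 <= a -> (forall j, `|z j 0| <= a) -> `|M *m z| <= max_row_sum M * a.
Proof.
move=> a0 za.
have M0 : 0 <= max_row_sum M by exact: bigmax_ge_id.
apply: mx_norm_le => [|i]; first exact: mulr_ge0.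
rewrite mxE; apply: le_trans (ler_norm_sum _ _ _) _.
apply: (@le_trans _ _ ((\sum_j `|M i j|) * a)).
  by rewrite mulr_suml ler_sum // => j _; rewrite normrM ler_wpM2l.
by rewrite ler_wpM2r // /max_row_sum (le_bigmax _ (fun i => \sum_j `|M i j|)).
Qed.

End Inner.

(** * Group norms over the partition, and the constant [triple_norm1] *)

Section Groups.
Context {R : realType} (p m : nat) (J : 'I_m -> {set 'I_p}).

Lemma inner_subrows (S : {set 'I_p}) (x y : 'cV[R]_p) :
  inner (subrows S x) (subrows S y) = \sum_(j in S) x j 0 * y j 0.
Proof. by rewrite innerE [RHS]big_enum_val; apply: eq_bigr => i _; rewrite !mxE. Qed.

Lemma subrowsD (S : {set 'I_p}) (x y : 'cV[R]_p) :
  subrows S (x + y) = subrows S x + subrows S y.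
Proof. by apply/matrixP => i j; rewrite !mxE. Qed.

Lemma subrowsZ (S : {set 'I_p}) a (x : 'cV[R]_p) :
  subrows S (a *: x) = a *: subrows S x.
Proof. by apply/matrixP => i j; rewrite !mxE. Qed.

Lemma subrowsN (S : {set 'I_p}) (x : 'cV[R]_p) : subrows S (- x) = - subrows S x.
Proof. by apply/matrixP => i j; rewrite !mxE. Qed.

Lemma norm1_group_norms (x : 'cV[R]_p) :
  norm1 (group_norms J x) = \sum_i enorm (subrows (J i) x).
Proof. by apply: eq_bigr => i _; rewrite mxE ger0_norm ?enorm_ge0. Qed.

Hypothesis J_partition : is_indexed_partition J.

Lemma sum_groups (F : 'I_p -> R) : \sum_j F j = \sum_i \sum_(j in J i) F j.
Proof.
have [J_inj J_part] := J_partition.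
have := set_partition_big (op := +%R) (E := F) _ J_part.
rewrite big_imset /=; last by move=> i j _ _ /J_inj.
under eq_bigl do rewrite finset.in_setT.
by under [X in _ = X -> _]eq_bigl do rewrite finset.in_setT.
Qed.

Lemma inner_groups (x y : 'cV[R]_p) :
  inner x y = \sum_i inner (subrows (J i) x) (subrows (J i) y).
Proof.
by rewrite innerE sum_groups; apply: eq_bigr => i _; rewrite inner_subrows.
Qed.

Lemma enorm_group_norms (x : 'cV[R]_p) : enorm (group_norms J x) = enorm x.
Proof.
rewrite /enorm inner_groups innerE; congr (Num.sqrt _); apply: eq_bigr => i _.
by rewrite mxE -expr2 sqr_enorm.
Qed.

(** Cauchy-Schwarz inside each group, then Hölder across groups. *)
Lemma inner_le_groups (x y : 'cV[R]_p) :
  inner x y <= `|group_norms J x| * norm1 (group_norms J y).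
Proof.
rewrite inner_groups norm1_group_norms mulr_sumr ler_sum // => i _.
apply: le_trans (inner_le_enorm _ _) _; rewrite ler_wpM2r ?enorm_ge0 //.
have := coord_le_mx_norm (group_norms J x) i.
by rewrite mxE ger0_norm ?enorm_ge0.
Qed.

(** Cauchy-Schwarz in dimension [m], against the indicator vector [u] of [S], whose norm is the
    square root of [#|S|]. *)
Lemma sum_enorm_groups_le (S : {set 'I_m}) (x : 'cV[R]_p) :
  \sum_(i in S) enorm (subrows (J i) x) <= Num.sqrt #|S|%:R * enorm x.
Proof.
pose u : 'cV[R]_m := \col_i (i \in S)%:R.
have -> : \sum_(i in S) enorm (subrows (J i) x) = inner u (group_norms J x).
  rewrite innerE big_mkcond /=; apply: eq_bigr => i _; rewrite !mxE.
  by case: ifP => _; rewrite ?mul1r ?mul0r.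
apply: le_trans (inner_le_enorm _ _) _; rewrite enorm_group_norms.
suff -> : enorm u = Num.sqrt #|S|%:R by [].
rewrite /enorm innerE; congr (Num.sqrt _).
rewrite -sum1_card natr_sum [RHS]big_mkcond /=; apply: eq_bigr => i _.
by rewrite !mxE; case: ifP => _; rewrite ?mulr1 ?mulr0.
Qed.

Lemma coord_le_norm1_groups (x : 'cV[R]_p) j :
  `|x j 0| <= norm1 (group_norms J x).
Proof.
have [_ J_part] := J_partition.
have : j \in finset.cover (J @: [set: 'I_m])%SET.
  by rewrite (cover_partition J_part) finset.in_setT.
case/finset.bigcupP => _ /imsetP[i _ ->] jJ.
rewrite norm1_group_norms (bigD1 i) //=.
apply: (@le_trans _ _ (enorm (subrows (J i) x))).
  apply: le_trans (ler_coord_enorm _ (enum_rank_in jJ j)).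
  by rewrite mxE enum_rankK_in.
by rewrite lerDl sumr_ge0 // => k _; rewrite enorm_ge0.
Qed.

Lemma norm1_ge0 n (x : 'cV[R]_n) : 0 <= norm1 x.
Proof. by rewrite sumr_ge0. Qed.

Let triple_set k (M : 'M[R]_(k, p)) : set R :=
  [set C : R | forall z, norm1 (M *m z) <= C * norm1 (group_norms J z)].

(** The sum of all [|M i j|] is admissible because each coordinate of [z] is at most the sum of its
    group norms. This keeps the infimum in [triple_norm1] off the empty set. *)
Lemma triple_norm1_bounded k (M : 'M[R]_(k, p)) : triple_set M !=set0.
Proof.
exists (\sum_i \sum_j `|M i j|) => z; rewrite mulr_suml ler_sum // => i _.
rewrite mxE mulr_suml; apply: le_trans (ler_norm_sum _ _ _) _.
rewrite ler_sum // => j _; rewrite normrM ler_wpM2l //.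
exact: coord_le_norm1_groups.
Qed.

(** The infimum is itself admissible: for fixed [z] with nonzero group norms, the quotient of the
    two norms is a lower bound of all admissible constants. *)
Lemma norm1_mul_le k (M : 'M[R]_(k, p)) z :
  norm1 (M *m z) <= triple_norm1 J M * norm1 (group_norms J z).
Proof.
have [z0|z0] := eqVneq (norm1 (group_norms J z)) 0.
  by have [C /(_ z)] := triple_norm1_bounded M; rewrite z0 !mulr0.
have zp : 0 < norm1 (group_norms J z) by rewrite lt_def z0 norm1_ge0.
rewrite -ler_pdivrMr //; apply: lb_le_inf; first exact: triple_norm1_bounded.
by move=> C /(_ z); rewrite ler_pdivrMr.
Qed.

Lemma triple_norm1_ge0 k (M : 'M[R]_(k, p)) : 0 <= triple_norm1 J M.
Proof.
have [[z zp]|nz] := pselect (exists z : 'cV[R]_p, 0 < norm1 (group_norms J z)).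
  by rewrite -(pmulr_lge0 _ zp) (le_trans _ (norm1_mul_le M z)) ?norm1_ge0.
(* This happens only for p = 0: every real is then an admissible constant,
   and inf takes its default value 0. *)
rewrite /triple_norm1 inf_out // => -[_ [l lP]].
have G0 (z : 'cV[R]_p) : norm1 (group_norms J z) = 0.
  apply/eqP; rewrite eq_le norm1_ge0 leNgt andbT; apply/negP => zp.
  by apply: nz; exists z.
have [C CP] := triple_norm1_bounded M.
have : l <= l - 1.
  by apply: lP => z; have := CP z; rewrite G0 !mulr0.
by rewrite lerBrDr gerDl ler10.
Qed.

End Groups.

(** * Lower bounds on differences of the loss *)

Section Loss.
Context {R : realType}.
Implicit Types (f theta : R -> R).

Lemma convex_functionE f : @convex_function R R^o setT f ->
  forall a s t, 0 <= a <= 1 -> f (a * s + (1 - a) * t) <= a * f s + (1 - a) * f t.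
Proof.
move=> f_convex a s t /andP[a0 a1].
by have := f_convex (Itv01 a0 a1) s t; apply; rewrite inE.
Qed.

Lemma convex_three_points f : @convex_function R R^o setT f ->
  forall s t u, s < t -> t < u -> (u - s) * f t <= (u - t) * f s + (t - s) * f u.
Proof.
move=> /convex_functionE f_convex s t u st tu.
have su : 0 < u - s by lra.
have a01 : 0 <= (u - t) / (u - s) <= 1.
  by rewrite divr_ge0 ?ler_pdivrMr //=; lra.
have := f_convex _ s u a01.
have -> : (u - t) / (u - s) * s + (1 - (u - t) / (u - s)) * u = t.
  by field; rewrite gt_eqF.
rewrite -(ler_pM2l su) => /le_trans; apply.
rewrite le_eqVlt; apply/orP; left; apply/eqP.
by field; rewrite gt_eqF.
Qed.

(** The left difference quotients at [t] are bounded above by every right one, so their supremum is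
    a subgradient. *)
Lemma subdifferential_neq0 f t : @convex_function R R^o setT f ->
  subdifferential f t !=set0.
Proof.
move=> f_convex.
pose E := [set (f t - f s) / (t - s) | s in [set s | s < t]].
have E0 : E !=set0 by exists ((f t - f (t - 1)) / (t - (t - 1))), (t - 1) => //=; lra.
have E_ub u : t < u -> ubound E ((f u - f t) / (u - t)).
  move=> tu _ [s /= st <-].
  have := convex_three_points f_convex st tu.
  rewrite ler_pdivrMr ?subr_gt0 // mulrAC ler_pdivlMr ?subr_gt0 //; lra.
have E_sup : has_sup E.
  by split=> //; exists ((f (t + 1) - f t) / (t + 1 - t)); apply: E_ub; lra.
exists (sup E) => s.
have [st|ts|->] := ltgtP s t; last by lra.
- have : (f t - f s) / (t - s) <= sup E by apply: ub_le_sup; [exact: E_sup.2|exists s].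
  by rewrite ler_pdivrMr ?subr_gt0 //; lra.
- have : sup E <= (f s - f t) / (s - t) by apply: ge_sup E0 (E_ub _ ts).
  by rewrite ler_pdivlMr ?subr_gt0 //; lra.
Qed.

(** Replaces a limit as [a] tends to 0 in first-order arguments. *)
Lemma ge0_of_small_steps (P K : R) :
  (forall a, 0 < a -> a < 1 -> 0 <= P + a * K) -> 0 <= P.
Proof.
move=> H; rewrite leNgt; apply/negP => P0.
have K1 : 0 < `|K| - P + 1 by have := normr_ge0 K; lra.
have K0 := normr_ge0 K.
(* With this [a], [P + a * |K|] equals [- a * (1 - P)], which is negative when [P < 0]. *)
pose a := - P / (`|K| - P + 1).
have a0 : 0 < a by rewrite divr_gt0 // oppr_gt0.
have a1 : a < 1 by rewrite ltr_pdivrMr //; lra.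
have := H a a0 a1.
have : a * K <= a * `|K| by rewrite ler_wpM2l ?ler_norm // ltW.
have : a * (`|K| - P + 1) = - P by rewrite /a divfK // gt_eqF.
nra.
Qed.

Variables (theta : R -> R) (rhobar rhotilde : R).
Hypothesis theta_loss : loss_assumption theta rhobar rhotilde.

Lemma loss_lipschitz s t : theta t - rhotilde * `|s - t| <= theta s.
Proof.
have [eta eta_t] := subdifferential_neq0 t (loss_convex theta_loss).
have := loss_subdifferential_bound theta_loss eta_t; have := eta_t s.
have : - (`|eta| * `|s - t|) <= eta * (s - t).
  by rewrite -normrM lerNl -normrN ler_norm.
by have := normr_ge0 (s - t); nra.
Qed.

Lemma loss_le_norm t : theta t <= rhotilde * `|t|.
Proof.
have := loss_lipschitz 0 t.
by rewrite (loss_at0 theta_loss) sub0r normrN; lra.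
Qed.

(** First-order form of the strong convexity of [theta ^+ 2] at [u], without differentiability:
    apply convexity at [y = a * z + (1 - a) * u], bound [theta y] below by the Lipschitz property,
    divide by [a] and let [a] tend to 0. *)
Lemma sqr_loss_lower z u :
  theta u ^+ 2 - 2 * rhotilde * theta u * `|z - u| + rhobar / 2 * (z - u) ^+ 2
    <= theta z ^+ 2.
Proof.
rewrite -subr_ge0.
apply: (@ge0_of_small_steps _ (rhobar / 2 * (z - u) ^+ 2)) => a a0 a1.
have := convex_functionE (loss_sq_strongly_convex theta_loss).
have a01 : 0 <= a <= 1 by rewrite !ltW.
move=> /(_ _ z u a01).
set y := a * z + (1 - a) * u => conv_y.
have lip := loss_lipschitz y u.
have y_u : `|y - u| = a * `|z - u|.
  have -> : y - u = a * (z - u) by rewrite /y; ring.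
  by rewrite normrM (gtr0_norm a0).
rewrite y_u in lip.
have u0 := loss_ge0 theta_loss u; have y0 := loss_ge0 theta_loss y.
have rt := loss_bound_gt0 theta_loss.
have d0 := normr_ge0 (z - u).
have sq : theta u ^+ 2 - 2 * theta u * (rhotilde * (a * `|z - u|)) <= theta y ^+ 2.
  have : 0 <= rhotilde * (a * `|z - u|) by rewrite !mulr_ge0 // ltW.
  set e := rhotilde * _ in lip * => e0.
  (* If [theta u <= e] the left side is at most 0; otherwise [theta u - e] is positive and the
     Lipschitz bound can be squared. *)
  by have [ue|eu] := lerP (theta u) e; nra.
rewrite -(pmulr_rge0 _ a0).
have y2 : y ^+ 2 = a * z ^+ 2 + (1 - a) * u ^+ 2 - a * (1 - a) * (z - u) ^+ 2.
  by rewrite /y; ring.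
by move: conv_y sq; rewrite y2; lra.
Qed.

(** Divide [sqr_loss_lower] by [theta z + theta u], which is at most [rhotilde * D]. The linear
    error carries the factor [theta u], hence vanishes for [u = 0]. *)
Lemma loss_coord_lower z u D : `|z| + `|u| <= D ->
  rhobar / 2 * (z - u) ^+ 2 / (rhotilde * D) - (u != 0)%:R * (2 * rhotilde * `|z - u|)
    <= theta z - theta u.
Proof.
move=> zuD; have rt := loss_bound_gt0 theta_loss.
have rb := loss_modulus_gt0 theta_loss.
have main := sqr_loss_lower z u.
have z0 := loss_ge0 theta_loss z; have u0 := loss_ge0 theta_loss u.
have d0 := normr_ge0 (z - u).
have sD : theta z + theta u <= rhotilde * D.
  have := loss_le_norm z; have := loss_le_norm u.
  have := ler_wpM2l (ltW rt) zuD; lra.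
set s := theta z + theta u in sD.
(* Division by [s] is impossible here, but both losses then vanish and strong convexity forces
   [z = u]. *)
have [s0|s0] := eqVneq s 0.
  have [z00 u00] : theta z = 0 /\ theta u = 0 by rewrite /s in s0; lra.
  have : (z - u) ^+ 2 <= 0.
    rewrite -(pmulr_rle0 _ rb); move: main; rewrite z00 u00; lra.
  move=> d20; have -> : (z - u) ^+ 2 = 0 by apply: le_anti; rewrite d20 sqr_ge0.
  rewrite mulr0 mul0r sub0r z00 u00 subr0 oppr_le0.
  by rewrite !mulr_ge0 ?ler0n // ltW.
have sp : 0 < s by rewrite lt_def s0 addr_ge0.
have Dp : 0 < rhotilde * D by exact: lt_le_trans sD.
rewrite -(ler_pM2l sp).
have H1 : s * (rhobar / 2 * (z - u) ^+ 2 / (rhotilde * D)) <= rhobar / 2 * (z - u) ^+ 2.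
  rewrite [leLHS]mulrCA ler_piMr //; last by rewrite ler_pdivrMr // mul1r.
  by rewrite mulr_ge0 ?sqr_ge0 // divr_ge0 // ltW.
have H2 : 2 * rhotilde * theta u * `|z - u|
    <= s * ((u != 0)%:R * (2 * rhotilde * `|z - u|)).
  have [->|un0] /= := eqVneq u 0.
    by rewrite (loss_at0 theta_loss) !(mulr0, mul0r).
  have : 0 <= rhotilde * `|z - u| by rewrite mulr_ge0 // ltW.
  by rewrite /s mul1r; nra.
by rewrite mulrBr; move: H1 H2; rewrite /s; nra.
Qed.

Lemma loss_lower n (d w : 'cV[R]_n) :
  rhobar / (2 * n%:R * (rhotilde * (`|d| + 2 * `|w|))) * enorm d ^+ 2
    - 2 * n%:R^-1 * rhotilde * norm1 (subrows (supp w) d)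
    <= loss theta (d - w) - loss theta (- w).
Proof.
set D := `|d| + 2 * `|w|.
have -> : norm1 (subrows (supp w) d) = \sum_i (w i 0 != 0)%:R * `|d i 0|.
  transitivity (\sum_(i in supp w) `|d i 0|).
    by rewrite [RHS]big_enum_val; apply: eq_bigr => i _; rewrite mxE.
  rewrite big_mkcond /=.
  apply: eq_bigr => i _; rewrite inE.
  by case: ifP => _; rewrite ?mul1r ?mul0r.
rewrite /loss -mulrBr -sumrB sqr_enormE.
have -> : rhobar / (2 * n%:R * (rhotilde * D)) * \sum_i d i 0 ^+ 2
    - 2 * n%:R^-1 * rhotilde * \sum_i (w i 0 != 0)%:R * `|d i 0|
  = n%:R^-1 * \sum_i (rhobar / 2 * d i 0 ^+ 2 / (rhotilde * D)
      - (w i 0 != 0)%:R * (2 * rhotilde * `|d i 0|)).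
  rewrite sumrB mulrBr !mulr_sumr; congr (_ - _); apply: eq_bigr => i _.
    by rewrite !invfM; ring.
  by ring.
rewrite ler_wpM2l ?invr_ge0 ?ler0n // ler_sum // => i _; rewrite !mxE.
(* [D] dominates [|d_i - w_i| + |w_i|] for all [i] at once, giving one common denominator. *)
have := @loss_coord_lower (d i 0 - w i 0) (- w i 0) D.
rewrite opprK subrK oppr_eq0; apply.
have := coord_le_mx_norm d i; have := coord_le_mx_norm w i.
by have := ler_normB (d i 0) (w i 0); rewrite normrN /D; lra.
Qed.

End Loss.

(** * The weights lie in [0, 1] *)

Section Weight.
Context {R : realType} (phi : R -> \bar R) (phiL : classL phi).

Let psi := restrict01 phi.

Lemma classL_ge0 t : 0 <= t <= 1 -> (0 <= phi t)%E.
Proof. by have [u [_ u_min <-]] := classL_argmin phiL; exact: u_min. Qed.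

(** The minimizer of [phi], where it is 0, bounds the supremum below; [phi >= 0] on [0, 1] bounds it
    above by [|s|]. *)
Lemma conjugate_fin_num s : conjugate psi s \is a fin_num.
Proof.
have [u [u01 _ phiu]] := classL_argmin phiL.
rewrite fin_numE; apply/andP; split.
  rewrite gt_eqF // (@lt_le_trans _ _ (s * u)%:E) ?ltNyr //.
  by apply: ereal_sup_ubound; exists u => //; rewrite /psi /restrict01 u01 phiu sube0.
rewrite lt_eqF // (@le_lt_trans _ _ `|s|%:E) ?ltry //.
apply: ge_ereal_sup => _ [t _ <-]; rewrite /psi /restrict01; case: ifP => [t01|_].
  apply: (@le_trans _ _ (s * t)%:E); first by rewrite geeDl // oppe_le0 classL_ge0.
  have /andP[t0 t1] := t01.
  by rewrite lee_fin (le_trans (ler_norm _)) // normrM (ger0_norm t0) ler_piMr.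
by rewrite /= leNye.
Qed.

Let psistar s : R := fine (conjugate psi s).

(** [psistar] is a supremum of affine functions with slopes [t] in [0, 1]: nonnegative slopes give
    this bound, slopes at most 1 the next one. *)
Lemma psistar_nondecreasing s h : 0 <= h -> psistar s <= psistar (h + s).
Proof.
move=> h0; rewrite -lee_fin !fineK ?conjugate_fin_num //.
apply: ge_ereal_sup => _ [t _ <-].
apply: (@le_trans _ _ (((h + s) * t)%:E - psi t)%E).
  rewrite /psi /restrict01; case: ifP => [t01|_]; last by rewrite /= leNye.
  by rewrite leeB // lee_fin; nra.
by apply: ereal_sup_ubound; exists t.
Qed.

Lemma psistar_lipschitz s h : 0 <= h -> psistar (h + s) <= h + psistar s.
Proof.
move=> h0; rewrite -lee_fin EFinD !fineK ?conjugate_fin_num //.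
apply: ge_ereal_sup => _ [t _ <-].
apply: (@le_trans _ _ (h%:E + ((s * t)%:E - psi t))%E).
  rewrite addeA -EFinD /psi /restrict01; case: ifP => [t01|_]; last by rewrite /= leNye.
  by rewrite leeB // lee_fin; nra.
by rewrite leeD2l //; apply: ereal_sup_ubound; exists t.
Qed.

Lemma conj_deriv_bounds s : 0 <= conj_deriv phi s <= 1.
Proof.
rewrite /conj_deriv /derive1 -/psi.
set F := (X in lim X).
(* Without convergence the limit takes its default value 0, also in [0, 1], so differentiability
   need not be shown. *)
have [F_cvg|/dvgP ->] := pselect (cvg F); last by rewrite lexx ler01.
have quot h : h != 0 -> 0 <= h^-1 *: (psistar (h + s) - psistar s : R^o) <= 1.
  rewrite /GRing.scale /= neq_lt => /orP[h0|h0].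
    have nh : 0 <= - h by rewrite oppr_ge0 ltW.
    have := psistar_nondecreasing (h + s) nh; have := psistar_lipschitz (h + s) nh.
    rewrite addKr => H1 H2.
    by rewrite mulrC ler_ndivlMr ?ler_ndivrMr //; lra.
  have h1 := ltW h0.
  have := psistar_nondecreasing s h1; have := psistar_lipschitz s h1 => H1 H2.
  by rewrite mulrC ler_pdivlMr ?ler_pdivrMr //; lra.
have near_quot : \forall h \near (0 : R)^',
    0 <= h^-1 *: (psistar (h + s) - psistar s : R^o) <= 1.
  by near=> h; apply: quot; near: h; exact: nbhs_dnbhs_neq.
apply/andP; split.
- by apply: limr_ge => //; apply: filterS near_quot => h /andP[].
- by apply: limr_le => //; apply: filterS near_quot => h /andP[].
Unshelve. all: by end_near. Qed.

End Weight.

(** * First-order inequality for the proximal subproblem *)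

Section FirstOrder.
Context {R : realType} (p : nat).

Lemma prox_mx_tr n (A : 'M[R]_(n, p)) g1 g2 : (prox_mx A g1 g2)^T = prox_mx A g1 g2.
Proof.
by rewrite /prox_mx linearD /= tr_scalar_mx linearZ /= trmx_mul trmxK.
Qed.

Lemma convex_setE (X : set 'cV[R]_p) :
  convex_set (X : set (convex_lmodType 'cV[R]_p)) ->
  forall a y z, 0 <= a <= 1 -> X y -> X z -> X (a *: y + (1 - a) *: z).
Proof.
move=> X_convex a y z /andP[a0 a1] Xy Xz.
by have := X_convex y z (Itv01 a0 a1) (mem_set Xy) (mem_set Xz) => /set_mem.
Qed.

(** Compare [x] with the feasible point [x - a *: (x - z)], divide by [a] and let [a] tend to 0.
    Writing [x = z + (x - z)] in the derivative of the [mu] term produces both [- mu *: z] and the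
    squared norm. *)
Lemma prox_minimizer_ineq (X : set 'cV[R]_p) (h : 'cV[R]_p -> R) (Q : 'M[R]_p)
    mu (y0 delta x z : 'cV[R]_p) :
  convex_set (X : set (convex_lmodType 'cV[R]_p)) ->
  (forall a y z, 0 <= a <= 1 ->
     h (a *: y + (1 - a) *: z) <= a * h y + (1 - a) * h z) ->
  Q^T = Q -> X z ->
  is_minimizer X (fun y => h y + mu / 2 * enorm y ^+ 2
    + 2^-1 * sqnorm_wrt Q (y - y0) - inner delta (y - y0)) x ->
  h x - h z <= inner (Q *m (y0 - x) + delta - mu *: z) (x - z)
               - mu * enorm (x - z) ^+ 2.
Proof.
move=> /convex_setE X_convex h_convex QT Xz [Xx x_min].
rewrite -subr_ge0; set d := x - z.
apply: (@ge0_of_small_steps _ _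
  (mu / 2 * inner d d + 2^-1 * inner d (Q *m d))) => a a0 a1.
have a01 : 0 <= a <= 1 by rewrite !ltW.
have := x_min _ (X_convex _ _ _ a01 Xz Xx); have := h_convex _ z x a01.
have -> : a *: z + (1 - a) *: x = x - a *: d.
  by rewrite /d scalerBl scale1r scalerBr opprB addrCA.
rewrite /= (addrAC x) /sqnorm_wrt.
set w := x - y0 => h_a.
rewrite -(pmulr_rge0 _ a0) !sqr_enorm.
have -> : y0 - x = - w by rewrite opprB.
set hz := h z in h_a *; have -> : z = x - d by rewrite /d opprB addrC subrK.
clearbody hz d w; rewrite !(mulmxDr, mulmxN, innerDl, innerDr, innerNl, innerNr,
  innerZl, innerZr).
rewrite -!scalemxAr !(innerZl, innerZr, innerDl, innerDr, innerNl, innerNr).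
rewrite (inner_symm d w QT) (innerC x d) (innerC (Q *m w) d) (inner_symm d w QT).
by move: h_a; lra.
Qed.

End FirstOrder.

(** * Scalar inequalities for the cone condition and the final estimate *)

Section Arith.
Context {R : realType}.

(** For [z = 0] the quotient is [y] times [+oo], and exceeding [r >= 0] forces [y > 0]. *)
Lemma lte_div_ge0 (r y z : R) : 0 <= r -> 0 <= z ->
  (r%:E < y%:E / z%:E)%E -> r * z < y.
Proof.
move=> r0; rewrite le_eqVlt => /predU1P[<-|z0].
  rewrite inve0 mulr0 ltNge => H; rewrite ltNge; apply: contra H => y0.
  by rewrite (@le_trans _ _ 0%E) ?lee_fin // mule_le0_ge0 ?lee_fin ?leey.
by rewrite inver gt_eqF // -EFinM lte_fin ltr_pdivlMr.
Qed.

(** Multiplying by [c] turns [B] into at most [lambda], which cancels; what remains is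
    [c * (t / 2 - s) <= s + t]. *)
Lemma cone_bound (c lambda B v K s t : R) :
  2 < c -> 0 < lambda -> v <= 1 -> c * B <= lambda -> 0 <= K -> 0 <= s -> 0 <= t ->
  K + lambda * (t / 2 - v * s) <= B * (s + t) ->
  t <= 2 * (c + 1) / (c - 2) * s.
Proof.
move=> c2 lp v1 cB K0 s0 t0 H.
have B_le : c * (B * (s + t)) <= lambda * (s + t).
  by rewrite mulrA ler_wpM2r // addr_ge0.
have : lambda * (c * (t / 2 - v * s)) <= lambda * (s + t) by nra.
rewrite (ler_pM2l lp) => H2.
have : c * (v * s) <= c * s by rewrite ler_wpM2l ?ler_piMl //; lra.
move=> H3; rewrite mulrAC ler_pdivlMr; lra.
Qed.

(* N = |D|, q = sqrt |S|, e = |varpi|_oo, M = |A D|_oo and Y = |A D|^2 / (2 n).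
   The case M = e = 0, where the quotient by M + 2 e is a junk 0, is settled by M = 0 -> N = 0. *)
Lemma error_bound (mu rb rt kappa N s q e M a beta Y : R) :
  0 < rb -> 0 < rt -> 0 <= mu -> 0 <= N -> 0 <= q -> 0 <= e -> 0 <= beta ->
  0 <= s -> 0 <= a -> 0 <= M -> M <= a * s -> s <= q * N ->
  (M = 0 -> N = 0) ->
  kappa * N ^+ 2 <= Y ->
  rb / (rt * (M + 2 * e)) * Y + mu * N ^+ 2 <= beta * s ->
  0 < 2 * mu * e + rb * kappa / rt - a * beta * q ^+ 2 ->
  N <= 2 * e * beta * q / (2 * mu * e + rb * kappa / rt - a * beta * q ^+ 2).
Proof.
move=> rb0 rt0 mu0 N0 q0 e0 beta0 s0 a0 M0 Ma sN MN kN main d2.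
rewrite ler_pdivlMr //.
have [->|Nn0] := eqVneq N 0; first by rewrite mul0r !mulr_ge0.
have Np : 0 < N by rewrite lt_def Nn0.
have Mp : 0 < M by rewrite lt_def M0 andbT; apply: contra Nn0 => /eqP/MN ->.
have Dp : 0 < M + 2 * e by lra.
(* Multiplied by [N], the goal follows by summing the four bounds below, in which [M] is replaced by
   [a * q * N] on the right and dropped from the [mu] term on the left. *)
rewrite -(ler_pM2r Np).
have main' : rb / rt * Y + mu * N ^+ 2 * (M + 2 * e) <= beta * s * (M + 2 * e).
  apply: le_trans (ler_wpM2r (ltW Dp) main); rewrite [leRHS]mulrDl lerD2r.
  by rewrite le_eqVlt; apply/orP; left; apply/eqP; field; rewrite !gt_eqF.
have kN' : rb / rt * (kappa * N ^+ 2) <= rb / rt * Y.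
  by rewrite ler_wpM2l // divr_ge0 // ltW.
have mN : mu * N ^+ 2 * (2 * e) <= mu * N ^+ 2 * (M + 2 * e).
  by rewrite ler_wpM2l ?mulr_ge0 ?sqr_ge0 //; lra.
have bs : beta * s * (M + 2 * e) <= beta * (q * N) * (a * (q * N) + 2 * e).
  apply: ler_pM; [by rewrite mulr_ge0 | by lra | by rewrite ler_wpM2l |].
  by rewrite lerD2r (le_trans Ma) // ler_wpM2l.
have -> : rb * kappa / rt = rb / rt * kappa by rewrite mulrAC.
by move: main' kN' mN bs; lra.
Qed.

End Arith.

(** * Convexity of the two nonsmooth terms of the subproblem *)

Section Convexity.
Context {R : realType}.

Lemma loss_affine_convex (theta : R -> R) n p (A : 'M[R]_(n, p)) (b : 'cV[R]_n) :
  @convex_function R R^o setT theta ->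
  forall a y z, 0 <= a <= 1 ->
  loss theta (A *m (a *: y + (1 - a) *: z) - b)
    <= a * loss theta (A *m y - b) + (1 - a) * loss theta (A *m z - b).
Proof.
move=> /convex_functionE theta_convex a y z a01.
have -> : A *m (a *: y + (1 - a) *: z) - b
    = a *: (A *m y - b) + (1 - a) *: (A *m z - b).
  rewrite mulmxDr -!scalemxAr !scalerBr addrACA -opprD -scalerDl.
  by rewrite (_ : a + (1 - a) = 1) ?scale1r // addrC subrK.
rewrite /loss (mulrCA a) (mulrCA (1 - a)) -mulrDr ler_wpM2l ?invr_ge0 ?ler0n //.
rewrite !mulr_sumr -big_split /= ler_sum // => i _; rewrite !mxE.
exact: theta_convex.
Qed.

Lemma weighted_groups_convex p m (J : 'I_m -> {set 'I_p}) (v : 'cV[R]_m) :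
  (forall i, 0 <= v i 0) ->
  forall a y z, 0 <= a <= 1 ->
  inner v (group_norms J (a *: y + (1 - a) *: z))
    <= a * inner v (group_norms J y) + (1 - a) * inner v (group_norms J z).
Proof.
move=> v0 a y z /andP[a0 a1]; rewrite !innerE !mulr_sumr -big_split /= ler_sum // => i _.
rewrite !mxE subrowsD !subrowsZ (mulrCA a) (mulrCA (1 - a)) -mulrDr ler_wpM2l //.
apply: le_trans (enormD _ _) _.
by rewrite !enormZ (ger0_norm a0) ger0_norm ?subr_ge0.
Qed.

End Convexity.

(* In the upper bound on lambda the quotient is taken in the extended reals,
   where y / 0 = +oo for y > 0; it is the real quotient whenever the
   denominator is nonzero. *)
Theorem theorem4 (R : realType) (n p m : nat) (n_gt0 : (0 < n)%N)
    (A : 'M[R]_(n, p)) (X : set 'cV[R]_p)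
    (X_neq0 : X !=set0) (X_closed : closed X)
    (X_convex : convex_set (X : set (convex_lmodType 'cV[R]_p)))
    (J : 'I_m -> {set 'I_p}) (J_partition : is_indexed_partition J)
    (b varpi : 'cV[R]_n) (xstar : 'cV[R]_p)
    (X_xstar : X xstar) (b_model : b = A *m xstar + varpi)
    (theta : R -> R) (rhobar rhotilde : R)
    (theta_loss : loss_assumption theta rhobar rhotilde)
    (phi : R -> \bar R) (mu nu rho varrho g1low g2low : R)
    (x delta : nat -> 'cV[R]_p) (g1 g2 : nat -> R)
    (x_pmm : inexact_pmm A b X J theta phi mu nu rho varrho g1low g2low
               x delta g1 g2)
    (c kappa : R) (c_gt2 : 2 < c) (kappa_gt0 : 0 < kappa)
    (restricted_eigenvalue : forall z : 'cV[R]_p,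
       group_cone J c (group_supp J xstar)
         (3 / 2 * #|group_supp J xstar|%:R) z ->
       kappa * enorm z ^+ 2 <= (2 * n%:R)^-1 * enorm (A *m z) ^+ 2)
    (k : nat) (k_ge1 : (1 <= k)%N)
    (S : {set 'I_m}) (S_supset : group_supp J xstar \subset S)
    (S_card : #|S|%:R <= 3 / 2 * #|group_supp J xstar|%:R :> R)
    (S_weight : forall i, i \in (~: S)%SET ->
       weight J phi rho (x k.-1) i 0 <= 1 / 2) :
  let lambda := rho * nu in
  let v := const_mx 1 - weight J phi rho (x k.-1) in
  let vmax := `|subrows (group_supp J xstar) v| in
  let B := `|group_norms J (xi A mu xstar x delta g1 g2 k)|
           + 2 * n%:R^-1 * rhotilde
             * triple_norm1 J (subrows (supp varpi) A) in
  let d1 := 2 * `|varpi| * (B + lambda * vmax) * Num.sqrt #|S|%:R in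
  let d2 := 2 * mu * `|varpi| + rhobar * kappa / rhotilde
            - 3 * c / (c - 2) * max_row_sum A * (B + lambda * vmax)
              * #|S|%:R in
  c * B <= lambda ->
  (lambda%:E <
     (2 * mu * `|varpi| + kappa * rhobar / rhotilde
        - 3 * c * max_row_sum A / (c - 2) * B * #|S|%:R)%:E
     / (3 * c * max_row_sum A / (c - 2) * vmax * #|S|%:R)%:E)%E ->
  enorm (x k - xstar) <= d1 / d2.
Proof.
move=> lambda v vmax B d1 d2 cB lambda_lt.
have phi_L := (pmm_phi x_pmm).1.
have mu0 := pmm_mu x_pmm; have nu0 := pmm_nu x_pmm; have rho1 := pmm_rho x_pmm.
have lambda0 : 0 < lambda by rewrite mulr_gt0 // (lt_le_trans _ rho1).
have w01 i : 0 <= weight J phi rho (x k.-1) i 0 <= 1.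
  by rewrite mxE; exact: conj_deriv_bounds phi_L _.
have vE i : v i 0 = 1 - weight J phi rho (x k.-1) i 0 by rewrite !mxE.
have v0 i : 0 <= v i 0 by rewrite vE; have := w01 i; lra.
have vmax0 : 0 <= vmax by exact: normr_ge0.
have vmax1 : vmax <= 1.
  apply: mx_norm_le => // i; rewrite mxE ger0_norm // vE.
  by have := w01 (enum_val i); lra.
set D := x k - xstar.
pose g i := enorm (subrows (J i) D).
have g0 i : 0 <= g i by exact: enorm_ge0.
set s := \sum_(i in S) g i; set t := \sum_(i in ~: S) g i.
have s0 : 0 <= s by rewrite sumr_ge0.
have t0 : 0 <= t by rewrite sumr_ge0.
have st : norm1 (group_norms J D) = s + t.
  rewrite norm1_group_norms (bigID (mem S)) /=; congr (_ + _).
  by apply: eq_bigl => i; rewrite finset.in_setC.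
pose h y := loss theta (A *m y - b) + lambda * inner v (group_norms J y).
have h_le : h (x k) - h xstar
    <= inner (xi A mu xstar x delta g1 g2 k) D - mu * enorm D ^+ 2.
  apply: (@prox_minimizer_ineq _ _ X h (prox_mx A (g1 k.-1) (g2 k.-1))
    mu (x k.-1) (delta k.-1)) => //.
  - move=> a y z a01.
    have := loss_affine_convex A b (loss_convex theta_loss) y z a01.
    have := weighted_groups_convex J v0 y z a01.
    by rewrite /h -(ler_pM2l lambda0); lra.
  - exact: prox_mx_tr.
  - have := pmm_step x_pmm k.-1; rewrite prednK // => -[Xxk xk_min].
    split=> // y Xy; have := xk_min y Xy.
    by rewrite /subproblem_objective /h -/lambda -/v; lra.
(* Outside [S], [xstar] vanishes and [v] is at least 1/2. On the support, the reverse triangle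
   inequality and [vmax] apply. On the rest of [S], where [vmax] need not bound [v], the difference
   is nonnegative. *)
have G_ge : t / 2 - vmax * s <= inner v (group_norms J (x k)) - inner v (group_norms J xstar).
  rewrite !innerE -sumrB (bigID (mem S)) /= addrC lerD //.
    rewrite /t mulr_suml (eq_bigl [pred i | i \notin S]); last first.
      by move=> i; rewrite finset.in_setC.
    rewrite ler_sum // => i /= iS; rewrite !mxE -mulrBr.
    have xstar0 : subrows (J i) xstar = 0.
      apply/eqP; apply: contraNT iS => xi0.
      by apply: (fintype.subsetP S_supset); rewrite inE.
    have gE : enorm (subrows (J i) (x k)) = g i.
      by rewrite /g /D subrowsD subrowsN xstar0 subr0.
    have := S_weight i; rewrite finset.in_setC iS => /(_ isT) wi.
    rewrite gE xstar0 (eqP (_ : enorm 0 == 0)) ?enorm_eq0 // subr0 mulrC.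
    by rewrite ler_wpM2r //; move: wi; rewrite mxE; lra.
  rewrite /s mulr_sumr -sumrN ler_sum // => i iS; rewrite !mxE -mulrBr.
  have xk_ge : enorm (subrows (J i) xstar) - g i <= enorm (subrows (J i) (x k)).
    rewrite /g /D subrowsD subrowsN.
    by have := enormB_ge (subrows (J i) (x k)) (subrows (J i) xstar).
  have [isup|nsup] := boolP (i \in group_supp J xstar).
    have vi : v i 0 <= vmax.
      have := coord_le_mx_norm (subrows (group_supp J xstar) v) (enum_rank_in isup i).
      by rewrite mxE enum_rankK_in // ger0_norm.
    move: xk_ge (g0 i) (v0 i) vi; rewrite vE !mxE; nra.
  have xstar0 : subrows (J i) xstar = 0.
    by apply/eqP; move: nsup; rewrite inE negbK.
  rewrite xstar0 (eqP (_ : enorm 0 == 0)) ?enorm_eq0 // subr0.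
  rewrite (@le_trans _ _ 0) ?oppr_le0 ?mulr_ge0 ?enorm_ge0 //.
  by have := v0 i; rewrite !mxE.
have loss_ge := loss_lower theta_loss (A *m D) varpi.
have xkE : A *m x k - b = A *m D - varpi.
  by rewrite b_model /D mulmxBr opprD addrA.
have xsE : A *m xstar - b = - varpi by rewrite b_model opprD addrA subrr add0r.
have supp_le := norm1_mul_le J_partition (subrows (supp varpi) A) D.
have xi_le := inner_le_groups J_partition (xi A mu xstar x delta g1 g2 k) D.
have subAD : subrows (supp varpi) (A *m D) = subrows (supp varpi) A *m D.
  by rewrite /subrows mul_rowsub_mx.
set M := `|A *m D| in loss_ge.
set Z := rhobar / _ * _ in loss_ge.
have n0 : (0 : R) < n%:R by rewrite ltr0n.
have rt0 := loss_bound_gt0 theta_loss.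
have rb0 := loss_modulus_gt0 theta_loss.
have M0 : 0 <= M by exact: normr_ge0.
have Z0 : 0 <= Z.
  rewrite /Z mulr_ge0 ?sqr_ge0 // divr_ge0 ?(ltW rb0) //.
  by rewrite !mulr_ge0 ?(ltW rt0) ?(ltW n0) // addr_ge0 // mulr_ge0.
have main : Z + mu * enorm D ^+ 2 + lambda * (t / 2 - vmax * s) <= B * (s + t).
  have := ler_wpM2l (ltW lambda0) G_ge.
  have c0 : 0 <= 2 * n%:R^-1 * rhotilde by rewrite !mulr_ge0 ?invr_ge0 // ltW.
  have := ler_wpM2l c0 supp_le; move: xi_le loss_ge h_le.
  by rewrite /h xkE xsE subAD /B st; lra.
have D_cone : t <= 2 * (c + 1) / (c - 2) * s.
  apply: (cone_bound c_gt2 lambda0 vmax1 cB _ s0 t0 main).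
  by rewrite addr_ge0 // mulr_ge0 ?sqr_ge0 // ltW.
have RE := restricted_eigenvalue D (ex_intro _ S (And3 S_supset S_card D_cone)).
have B0 : 0 <= B.
  rewrite addr_ge0 // mulr_ge0 ?triple_norm1_ge0 //.
  by rewrite !mulr_ge0 ?invr_ge0 // ltW.
have beta0 : 0 <= B + lambda * vmax by rewrite addr_ge0 // mulr_ge0 // ltW.
have c_gt0 : 0 < c by lra.
have c20 : 0 < c - 2 by rewrite subr_gt0.
have Arow0 : 0 <= max_row_sum A by exact: bigmax_ge_id.
have a0 : 0 <= 3 * c / (c - 2) * max_row_sum A.
  by rewrite mulr_ge0 // divr_ge0 // ?mulr_ge0 //; lra.
(* The constant is [1 + 2 * (c + 1) / (c - 2) = 3 * c / (c - 2)]. *)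
have M_le : M <= 3 * c / (c - 2) * max_row_sum A * s.
  apply: (@le_trans _ _ (max_row_sum A * (s + t))).
    apply: ler_mul_max_row_sum; first by rewrite addr_ge0.
    by move=> j; rewrite -st; exact: coord_le_norm1_groups.
  rewrite mulrAC mulrC ler_wpM2r // -(ler_pM2r c20) (mulrAC _ s) divfK ?gt_eqF //.
  move: D_cone; rewrite mulrAC ler_pdivlMr //; lra.
have sqS : Num.sqrt #|S|%:R ^+ 2 = #|S|%:R :> R by rewrite sqr_sqrtr ?ler0n.
(* This is the upper bound on [lambda] with its denominator cleared. *)
have d2_gt0 : 0 < d2.
  have den0 : 0 <= 3 * c * max_row_sum A / (c - 2) * vmax * #|S|%:R.
    by rewrite !mulr_ge0 ?invr_ge0 ?(ltW c20) // ltW.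
  have := lte_div_ge0 (ltW lambda0) den0 lambda_lt.
  by rewrite /d2; lra.
rewrite /d1 /d2.
have := @error_bound R mu rhobar rhotilde kappa (enorm D) s (Num.sqrt #|S|%:R)
  `|varpi| M (3 * c / (c - 2) * max_row_sum A) (B + lambda * vmax)
  ((2 * n%:R)^-1 * enorm (A *m D) ^+ 2).
rewrite sqS; apply=> //.
- exact: ltW.
- exact: enorm_ge0.
- exact: sum_enorm_groups_le.
(* If [A *m D = 0], the restricted eigenvalue condition forces [D = 0]. *)
- move=> /normr0_eq0 AD0; move: RE; rewrite AD0.
  rewrite (eqP (_ : enorm 0 == 0)) ?enorm_eq0 // expr0n mulr0 => RE0.
  by apply/eqP; rewrite -sqrf_eq0 eq_le sqr_ge0 -(pmulr_rle0 _ kappa_gt0) RE0.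
- have -> : rhobar / (rhotilde * (M + 2 * `|varpi|)) * ((2 * n%:R)^-1 * enorm (A *m D) ^+ 2) = Z.
    by rewrite /Z !invfM; ring.
  (* Since [c > 2], [c * B <= lambda] gives [B <= lambda / 2], so the [t] terms can be discarded
     from [main]. *)
  have Bl : 0 <= (lambda / 2 - B) * t.
    rewrite mulr_ge0 // subr_ge0 ler_pdivlMr //.
    by rewrite (le_trans _ cB) // mulrC ler_wpM2r // ltW.
  by move: main Bl; lra.
Qed.
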